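(* For an integer $k>1$ let $M_k$ denote the $k\times k$ Collatz matrix (defined in the context), viewed as a matrix over the polynomial ring $\mathbb{Z}[x]$. Let $l$ be a positive integer. (a) Suppose $k=44+54l$. Then $\det M_k=\det M_{k-1}$ in each of the following cases: (i) $3\mid l$ or $3\mid (l-1)$; (ii) $l=2+3l_1$ for an integer $l_1$ with $3\mid (l_1-1)$; (iii) $l=2+3l_1$ for an integer $l_1$, and either (1) $l_1=3l_2$ for an integer $l_2$ with $3\mid l_2$, or (2) $l_1=2+3l_2$ for an integer $l_2$ with $3\mid l_2$ or $3\mid (l_2-1)$. (b) Suppose $k=26+54l$. Then $\det M_k=\det M_{k-1}$ in each of the following cases: (i) $3\mid (l-2)$; (ii) either (1) $l=1+3l_1$ for an integer $l_1$ with $3\mid l_1$, or (2) $l=3l_1$ for an integer $l_1$ with $3\mid l_1$.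
   Context: For each integer $k>1$, the Collatz matrix $M_k$ is the $k\times k$ matrix with entries in $\mathbb{Z}[x]$ (indeterminate $x$) defined as follows, with rows and columns indexed by $1,\dots,k$: every diagonal entry $(i,i)$ equals $1$; for each even $i$ with $1<i\le k$, the $(i,i/2)$-entry equals $x$; for each odd $i$ with $\frac{3i+1}{2}\le k$, the $(i,\frac{3i+1}{2})$-entry equals $x$; all other entries are $0$. For example, $M_2=\begin{pmatrix}1&x\\ x&1\end{pmatrix}$ and $M_4=\begin{pmatrix}1&x&0&0\\ x&1&0&0\\ 0&0&1&0\\ 0&x&0&1\end{pmatrix}$. *)

(* Defs.v *)
From HB Require Import structures.
From mathcomp Require Import all_boot all_order all_algebra.

Set Implicit Arguments.
Unset Strict Implicit.
Unset Printing Implicit Defensive.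

Import GRing.Theory.
Local Open Scope ring_scope.

(* Entry (r, c) in 1-based indices.  The three non-zero cases are mutually
   exclusive for r >= 1. *)
Definition collatz_entry (r c : nat) : {poly int} :=
  if r == c then 1
  else if ~~ odd r && (c == r %/ 2)%N then 'X
  else if odd r && (c == (3 * r + 1) %/ 2)%N then 'X
  else 0.

(* Ordinals are 0-based, hence the successors. *)
Definition collatz_mx (k : nat) : 'M[{poly int}]_k :=
  \matrix_(i < k, j < k) collatz_entry i.+1 j.+1.

(* Main.v *)
(** If [y] solves [M_k y = e_k], multiplying by the adjugate gives
    [y_k * det M_k = det M_(k-1)], the (k,k) cofactor of [M_k]. Such a [y] is
    read off the backward orbit of [k] under the Collatz map restricted to
    [1..k]: let [y_i] be the sum of [(-x)^n] over the [n] such that the [n]-th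
    iterate of [i] is [k]. The sum is finite, and [y_k = 1], as soon as the
    backward orbit of [k] has bounded depth. In each congruence class of the
    theorem, following predecessors [2m] and [(2m-1)/3] that stay at most [k]
    stops after at most eight steps. *)
Require Import Defs.
From HB Require Import structures.
From mathcomp Require Import all_boot all_order all_algebra.
From mathcomp Require Import zify.

Set Implicit Arguments.
Unset Strict Implicit.
Unset Printing Implicit Defensive.

Import Order.TTheory GRing.Theory Num.Theory.
Local Open Scope ring_scope.

Definition collatz (n : nat) : nat :=
  if odd n then ((3 * n + 1) %/ 2)%N else (n %/ 2)%N.

(* The value 0 is a sink that stands for leaving [1..k]. *)
Definition collatz_upto (k n : nat) : nat :=
  if (collatz n <= k)%N then collatz n else 0%N.

Definition no_ancestor (k d m : nat) : Prop :=
  forall i, (i <= k)%N -> iter d (collatz_upto k) i <> m.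

Lemma collatz_upto_le k n : (collatz_upto k n <= k)%N.
Proof. by rewrite /collatz_upto; case: ifP. Qed.

Lemma iter_collatz_upto_le k d i :
  (i <= k)%N -> (iter d (collatz_upto k) i <= k)%N.
Proof. by case: d => //= d _; apply: collatz_upto_le. Qed.

Lemma iter_collatz_upto0 k d : iter d (collatz_upto k) 0 = 0%N.
Proof. by elim: d => //= d ->. Qed.

(** Only [2 * m] and [(2 * m - 1) / 3] can map to [m]; the equation [3 * j + 1 = 2 * m] already
    forces [j] to be odd. Positivity of [m] rules out arrival through the sink. *)
Lemma no_ancestorS k d m : (0 < m)%N ->
  ((2 * m <= k)%N -> no_ancestor k d (2 * m)) ->
  (forall j, (3 * j + 1 = 2 * m)%N -> (j <= k)%N -> no_ancestor k d j) ->
  no_ancestor k d.+1 m.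
Proof.
move=> m_gt0 even_pred odd_pred i le_ik /=.
have := iter_collatz_upto_le d le_ik.
case E: (iter d _ i) => [|j] le_jk; first by move=> m0; rewrite -m0 in m_gt0.
rewrite -E /collatz_upto /collatz E; case: ifP => _; last by lia.
case: ifP => odd_j def_m.
  by apply: (odd_pred j.+1 _ _ i) => //; lia.
have def_2m : j.+1 = (2 * m)%N by lia.
by apply: (even_pred _ i) => //; rewrite -def_2m.
Qed.

(** On a cycle through [k] one can step back any number of times: the point [n * d] steps after [k]
    is [d] steps before a return to [k]. *)
Lemma no_ancestor_aperiodic k d n :
  no_ancestor k d k -> iter n.+1 (collatz_upto k) k <> k.
Proof.
move=> noK per.
have iterM q : iter (n.+1 * q) (collatz_upto k) k = k.
  by elim: q => [|q IHq]; rewrite ?muln0 // mulnS iterD IHq.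
apply: (noK (iter (n * d) (collatz_upto k) k)).
  exact: iter_collatz_upto_le.
by rewrite -iterD -mulSn iterM.
Qed.

Definition hit_series (k d i : nat) : {poly int} :=
  \sum_(n < d) (- 'X) ^+ n *+ (iter n (collatz_upto k) i == k).

Lemma hit_series0 k d : (0 < k)%N -> hit_series k d 0 = 0.
Proof.
move=> k_gt0; apply: big1 => n _.
by rewrite iter_collatz_upto0 eq_sym eqn0Ngt k_gt0.
Qed.

Lemma hit_series_self k d : no_ancestor k d k -> hit_series k d k = 1.
Proof.
case: d => [/(_ k (leqnn k))//|d] noK.
rewrite /hit_series big_ord_recl eqxx expr0 big1 ?addr0 // => n _.
by case: eqP => // /(no_ancestor_aperiodic noK).
Qed.

(** This is row [i] of [M_k y = e_k]. Multiplication by ['X] shifts the series of the next iterate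
    by one step and flips its sign, so the sum telescopes. *)
Lemma hit_series_step k d i : (i <= k)%N -> no_ancestor k d k ->
  hit_series k d i + 'X * hit_series k d (collatz_upto k i) = (i == k)%:R.
Proof.
move=> le_ik noK; rewrite /hit_series.
have -> : 'X * (\sum_(n < d) (- 'X) ^+ n *+
                  (iter n (collatz_upto k) (collatz_upto k i) == k)) =
  - \sum_(n < d) (- 'X) ^+ n.+1 *+ (iter n.+1 (collatz_upto k) i == k)
    :> {poly int}.
  rewrite mulr_sumr -sumrN; apply: eq_bigr => n _.
  by rewrite mulrnAr -mulNrn exprS mulNr opprK iterSr.
(* The same sum is peeled at its last term on the left, which vanishes by [noK], and at its first
   term on the right, which is [(i == k)%:R]. *)
have : \sum_(n < d.+1) (- 'X) ^+ n *+ (iter n (collatz_upto k) i == k) =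
    \sum_(n < d.+1) (- 'X) ^+ n *+ (iter n (collatz_upto k) i == k)
    :> {poly int} by [].
rewrite {1}big_ord_recr big_ord_recl /=; case: eqP => [/(noK i le_ik)//|_].
by rewrite mulr0n addr0 expr0 => ->; rewrite addrK.
Qed.

(** A positive [r] is never fixed by [collatz], so the ['X] entry never falls on the diagonal. *)
Lemma collatz_entryE r c : (0 < r)%N ->
  collatz_entry r c = (c == r)%:R + 'X *+ (c == collatz r).
Proof.
move=> r_gt0; rewrite /collatz_entry /collatz eq_sym.
have [->|ne_cr] := eqVneq c r.
  by rewrite (_ : (r == _) = false) ?addr0 //; case: ifP => ?; apply/eqP; lia.
by rewrite add0r; case: (odd r) => /=; case: eqP.
Qed.

(** As [f] vanishes at the sink, a column index outside [1..k] may be replaced by 0, just as in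
    [collatz_upto]. *)
Lemma sum_ord_delta (R : pzRingType) k m (a : R) (f : nat -> R) : f 0 = 0 ->
  \sum_(j < k) a *+ (j.+1 == m) * f j.+1 = a * f (if (m <= k)%N then m else 0%N).
Proof.
move=> f0; case: m => [|m]; first by rewrite /= f0 mulr0 big1 // => j _; rewrite mul0r.
case: ltnP => [lt_mk|le_km].
  rewrite (bigD1 (Ordinal lt_mk)) //= eqxx big1 ?addr0 // => j.
  by rewrite -val_eqE /= eqSS => /negPf->; rewrite mul0r.
rewrite f0 mulr0 big1 // => j _.
by rewrite eqSS ltn_eqF ?mul0r // (leq_trans (ltn_ord j)).
Qed.

Lemma det_collatz_mx_pred k d : (0 < k)%N -> no_ancestor k d k ->
  \det (collatz_mx k) = \det (collatz_mx k.-1).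
Proof.
case: k => // k _ noK /=; set M := collatz_mx k.+1.
pose y := \col_(i < k.+1) hit_series k.+1 d i.+1.
have My : M *m y = \col_i (i == ord_max)%:R.
  apply/matrixP => i j; rewrite !mxE.
  rewrite -[RHS](_ : (i.+1 == k.+1)%:R = _); last by rewrite -val_eqE eqSS.
  rewrite -(hit_series_step (ltn_ord i) noK).
  under eq_bigr => c _ do rewrite !mxE collatz_entryE // mulrDl.
  rewrite big_split /= !(sum_ord_delta _ _ _ (hit_series0 d (ltn0Sn k))).
  by rewrite ltn_ord mul1r.
have -> : collatz_mx k = row' ord_max (col' ord_max M).
  by apply/matrixP => i j; rewrite !mxE !lift_max.
have := congr1 (fun v => (\adj M *m v) ord_max 0) My.
rewrite mulmxA mul_adj_mx mul_scalar_mx !mxE hit_series_self // mulr1 => ->.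
rewrite (bigD1 ord_max) //= big1 ?addr0 => [|i /negPf ne_i]; last first.
  by rewrite !mxE ne_i mulr0.
(* The corner cofactor carries an even power of -1. *)
by rewrite !mxE eqxx mulr1 /cofactor addnn -signr_odd odd_double mul1r.
Qed.

(** Walks the backward tree depth first; [lia] closes a branch once the bound by [k] or the
    congruences on [l] exclude the predecessor. *)
Ltac no_ancestor_search :=
  first [ exfalso; lia
        | apply: no_ancestorS;
          [ lia | move=> ?; no_ancestor_search
          | move=> ? ? ?; no_ancestor_search ] ].

Theorem theorem2p1 (k l : nat) (hk : (1 < k)%N) (hl : (0 < l)%N) :
  (k = (44 + 54 * l)%N ->
     (* (i) *)
     ((3 %| l%:Z)%Z \/ (3 %| l%:Z - 1)%Z ->
        \det (collatz_mx k) = \det (collatz_mx k.-1))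
     (* (ii) *)
  /\ ((exists l1 : int, l%:Z = 2 + 3 * l1 /\ (3 %| l1 - 1)%Z) ->
        \det (collatz_mx k) = \det (collatz_mx k.-1))
     (* (iii) *)
  /\ ((exists l1 : int, l%:Z = 2 + 3 * l1 /\
         ((exists l2 : int, l1 = 3 * l2 /\ (3 %| l2)%Z)
          \/ (exists l2 : int, l1 = 2 + 3 * l2 /\
                ((3 %| l2)%Z \/ (3 %| l2 - 1)%Z)))) ->
        \det (collatz_mx k) = \det (collatz_mx k.-1)))
  /\
  (k = (26 + 54 * l)%N ->
     (* (i) *)
     ((3 %| l%:Z - 2)%Z ->
        \det (collatz_mx k) = \det (collatz_mx k.-1))
     (* (ii) *)
  /\ ((exists l1 : int, l%:Z = 1 + 3 * l1 /\ (3 %| l1)%Z)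
      \/ (exists l1 : int, l%:Z = 3 * l1 /\ (3 %| l1)%Z) ->
        \det (collatz_mx k) = \det (collatz_mx k.-1))).
Proof.
have k_gt0 := ltnW hk.
(* Backward chains from [k] have at most eight steps in every case, so depth 9 serves all of
   them. *)
split=> def_k; [split; [|split] | split] => case_l; apply: (@det_collatz_mx_pred k 9) => //.
- by case: case_l => ?; no_ancestor_search.
- by case: case_l => l1 [? ?]; no_ancestor_search.
- by case: case_l => l1 [? [[l2 [? ?]]|[l2 [? [?|?]]]]]; no_ancestor_search.
- by no_ancestor_search.
- by case: case_l => [[l1 [? ?]]|[l1 [? ?]]]; no_ancestor_search.
Qed.
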